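(* Let $K$ be a field and let $s\ge 2$ be an integer. There is $N$ such that for every prime $n\ge N$ the following holds. The algebra of generic matrices $K\{X\}$ of order $n$ with $s$ generators is a domain. It has a skew field of fractions as its localization, and this localization coincides (inside $M_n(K(x_{ij}^{(\nu)}))$) with the localization (skew field of fractions) of the algebra $K_T\{X\}$ of generic matrices with traces if $\operatorname{char} K=0$, respectively with forms (characteristic coefficients) if $\operatorname{char}K>0$.
   Context: Let $x_{ij}^{(\nu)}$ ($1\le i,j\le n$, $1\le\nu\le s$) be independent commuting indeterminates, and let $X_\nu=(x_{ij}^{(\nu)})\in M_n(K[x_{ij}^{(\nu)}])$. The algebra of generic matrices $K\{X\}=K\langle X_1,\dots,X_s\rangle$ is the $K$-subalgebra of $M_n(K[x_{ij}^{(\nu)}])$ generated by $X_1,\dots,X_s$. For an $n\times n$ matrix $A$, the characteristic coefficients (forms) $\xi_k(A)$, $1\le k\le n$, are the sums of principal minors of order $k$, so that $A^n-\xi_1(A)A^{n-1}+\cdots+(-1)^n\xi_n(A)=0$; in particular $\xi_1=\operatorname{tr}$. $K_T\{X\}$ denotes the subalgebra of $M_n(K[x_{ij}^{(\nu)}])$ generated by $K\{X\}$ and the scalar matrices $\operatorname{tr}(a)\cdot 1$ (if $\operatorname{char}K=0$), respectively the scalar matrices $\xi_k(a)\cdot 1$, $1\le k\le n$ (if $\operatorname{char}K>0$), for all $a\in K\{X\}$. *)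

(* Defs.v *)
From HB Require Import structures.
From mathcomp Require Import all_boot all_order all_algebra.
From mathcomp Require Import mpoly.

Set Implicit Arguments.
Unset Strict Implicit.
Unset Printing Implicit Defensive.

Import GRing.Theory.
Local Open Scope ring_scope.

(* Subsets of a ring are Prop-valued predicates. Square matrices of arbitrary
   size n are only a pzRingType in MathComp (no unitRingType structure), so
   inverses are described relationally. *)

Section RingSubsets.
Variable R : pzRingType.
Implicit Types A S D : R -> Prop.

Definition nonzero A : R -> Prop := fun a => A a /\ a <> 0.

Definition is_subring D : Prop :=
  [/\ D 1,
      (forall a b, D a -> D b -> D (a - b)) &
      (forall a b, D a -> D b -> D (a * b))].

Definition is_inverse (a b : R) : Prop := a * b = 1 /\ b * a = 1.

Definition is_domain A : Prop :=
  (1 : R) <> 0 /\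
  forall a b, A a -> A b -> a * b = 0 -> a = 0 \/ b = 0.

Definition is_skew_field D : Prop :=
  [/\ is_subring D,
      (1 : R) <> 0 &
      forall d, D d -> d <> 0 -> exists2 e, D e & is_inverse d e].

(* D is, inside R, the two-sided Ore localization of A at S. *)
Definition is_localization A S D : Prop :=
  [/\ is_subring D,
      (forall a, A a -> D a),
      (forall u, S u -> exists2 v, D v & is_inverse u v),
      (forall d, D d ->
         exists a u v, [/\ A a, S u, is_inverse u v & d = a * v]) &
      (forall d, D d ->
         exists a u v, [/\ A a, S u, is_inverse u v & d = v * a])].

Definition is_skew_field_of_fractions A D : Prop :=
  is_skew_field D /\ is_localization A (nonzero A) D.

End RingSubsets.

(* Sum of the principal minors of order k. *)
Definition char_coef (R : comNzRingType) (n k : nat) (A : 'M[R]_n) : R :=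
  \sum_(I : {set 'I_n} | #|I| == k)
    \det (mxsub (fun i : 'I_#|I| => enum_val i)
                (fun j : 'I_#|I| => enum_val j) A).

Section GenericMatrices.
Variables (K : fieldType) (s n : nat).

(* The indeterminates are indexed by the triples (nu, i, j), through the
   enumeration of this finite type. *)
Definition nvars : nat := #|{: 'I_s * 'I_n * 'I_n}|.


Definition generic_mx (nu : 'I_s) : 'M[{mpoly K[nvars]}]_n :=
  \matrix_(i, j) 'X_(enum_rank (nu, i, j)).

(* The unital K-subalgebra of M_n(K[x_ij^(nu)]) generated by G. *)
Inductive generated_alg (G : 'M[{mpoly K[nvars]}]_n -> Prop) :
    'M[{mpoly K[nvars]}]_n -> Prop :=
| gen_base a : G a -> generated_alg G a
| gen_scalar (c : K) : generated_alg G (c%:MP)%:M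
| gen_add a b : generated_alg G a -> generated_alg G b ->
    generated_alg G (a + b)
| gen_mul a b : generated_alg G a -> generated_alg G b ->
    generated_alg G (a *m b).

Definition generic_alg : 'M[{mpoly K[nvars]}]_n -> Prop :=
  generated_alg (fun a => exists nu, a = generic_mx nu).

Definition generic_alg_traces : 'M[{mpoly K[nvars]}]_n -> Prop :=
  generated_alg (fun z => generic_alg z \/
    exists2 a, generic_alg a & z = (\tr a)%:M).

Definition generic_alg_forms : 'M[{mpoly K[nvars]}]_n -> Prop :=
  generated_alg (fun z => generic_alg z \/
    exists a k, [/\ generic_alg a, (1 <= k <= n)%N &
                    z = (char_coef k a)%:M]).

(* The image of a subset of M_n(K[x_ij^(nu)]) in M_n(K(x_ij^(nu))). *)
Definition in_frac (A : 'M[{mpoly K[nvars]}]_n -> Prop) :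
    'M[{fraction {mpoly K[nvars]}}]_n -> Prop :=
  fun z => exists2 a, A a & z = map_mx (@tofrac {mpoly K[nvars]}) a.

End GenericMatrices.

(* Main.v *)
Require Import Defs.
From HB Require Import structures.
From mathcomp Require Import all_boot all_order all_algebra.
From mathcomp Require Import perm.
From mathcomp Require Import mpoly.
From Stdlib Require Import Classical_Prop.

Set Implicit Arguments.
Unset Strict Implicit.
Unset Printing Implicit Defensive.

Import GRing.Theory.
Local Open Scope ring_scope.

(** The whole proof rests on Capelli sums and on one grading; no structure
    theory of division algebras enters.

    Nonzero generic elements have nonzero determinant.  Give the variable
    x_ij as degree the remainder of j - i modulo n.  In a matrix a of K{X} the
    (i, j) entry is concentrated in degrees congruent to j - i, and moving one
    step down the diagonal applies the ring endomorphism sigma that sends x_ij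
    to x_(i+1)(j+1); both properties hold for the generators and are preserved
    by sums and products.
    Hence the component of a of lowest degree k is a cyclic permutation matrix
    with weights c, sigma(c), sigma(sigma(c)), ..., which all vanish as soon as
    one of them does.  If a <> 0, the determinant of this component is nonzero,
    and it is the lowest component of det a ([graded_det_neq0],
    [generic_det_neq0]).

    A conductor.  Let c(x; y) = sum_s sgn(s) prod_k x_(s k) y_k, with n^2
    arguments x_k.  Being alternating in the x_k, it is the determinant of
    their coordinates times a factor that depends on y only
    ([capelli_coord]).  Multiplication by a on the right (or left) of the x_k
    multiplies that determinant by det(a)^n, so
    c(xa; y) = det(a)^n c(x; y) = c(ax; y).  The words X_1^p X_2 X_1^q
    specialise to the matrix units when X_1 becomes the cyclic permutation
    matrix and X_2 becomes E_00 ([generic_units]); this provides x and y in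
    K{X} with u = c(x; y) <> 0.  Then det(a)^n u lies in both aA and Aa for
    A = K{X}, and, replacing a by 1 - ta, every coefficient of det(1 - ta)^n
    multiplied by u lies in A ([conductor]).

    The Ore conditions follow at once, because det(a)^n and det(s)^n are
    central: det(a)^n det(s)^n u^2 is a common multiple of a and s on both
    sides.  So A has a skew field of fractions D.

    Finally D contains the coefficients of det(1 - ta)^n, namely the elements
    of A found above divided by u.  When n is invertible, the coefficients of a
    polynomial with constant term 1 are polynomials in those of its n-th
    power ([coef_root_subring]), so D contains the coefficients
    (-1)^k xi_k(a) of det(1 - ta) ([coef_revdet]).  The algebras with traces or
    with forms therefore lie between A and D and have the same skew field of
    fractions.  It is enough to take N larger than the characteristic of K. *)

(** * Subrings given by predicates *)

Section SubringTheory.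
Variables (R : pzRingType) (A : R -> Prop).
Hypothesis subA : is_subring A.

Lemma subring1 : A 1. Proof. by case: subA. Qed.
Lemma subringB a b : A a -> A b -> A (a - b).
Proof. by case: subA => _ + _; apply. Qed.
Lemma subringM a b : A a -> A b -> A (a * b).
Proof. by case: subA => _ _; apply. Qed.
Lemma subring0 : A 0.
Proof. by rewrite -(subrr 1); apply: subringB subring1 subring1. Qed.
Lemma subringN a : A a -> A (- a).
Proof. by rewrite -sub0r; apply/subringB/subring0. Qed.
Lemma subringD a b : A a -> A b -> A (a + b).
Proof. by move=> Aa Ab; rewrite -[b]opprK; apply/subringB/subringN. Qed.
Lemma subring_sum I r (P : pred I) (F : I -> R) :
  (forall i, P i -> A (F i)) -> A (\sum_(i <- r | P i) F i).
Proof. exact: (big_ind A subring0 subringD). Qed.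
Lemma subring_prod I r (P : pred I) (F : I -> R) :
  (forall i, P i -> A (F i)) -> A (\prod_(i <- r | P i) F i).
Proof. exact: (big_ind A subring1 subringM). Qed.
Lemma subringX a k : A a -> A (a ^+ k).
Proof.
by move=> Aa; elim: k => [|k IH]; [apply: subring1 | rewrite exprS; apply: subringM].
Qed.
End SubringTheory.

(** * Capelli sums *)

Section Capelli.
Variables (R : comNzRingType) (n' m : nat).
Local Notation n := n'.+1.
Implicit Types x y : 'I_m -> 'M[R]_n.

Definition capelli x y : 'M[R]_n :=
  \sum_(s : 'S_m) (-1) ^+ s *: \prod_k (x (s k) * y k).

Lemma eq_capelli x x' y : x =1 x' -> capelli x y = capelli x' y.
Proof.
move=> eq_x; apply: eq_bigr => s _; congr (_ *: _).
by apply: eq_bigr => k _; rewrite eq_x.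
Qed.

(** An additive subgroup containing every summand contains the Capelli sum;
    stated for additive subgroups so that it applies to ideals such as aA. *)
Lemma capelli_ind x y (P : 'M[R]_n -> Prop) :
  P 0 -> (forall a b, P a -> P b -> P (a - b)) ->
  (forall s : 'S_m, P (\prod_k (x (s k) * y k))) -> P (capelli x y).
Proof.
move=> P0 PB Pprod.
have PN a : P a -> P (- a) by rewrite -sub0r; apply: PB.
apply: big_ind => // [a b Pa Pb | s _]; first by rewrite -[b]opprK; apply/PB/PN.
by rewrite scaler_sign; case: ifP => _; [apply: PN | ].
Qed.

(** Expanding the x_k on a family E turns the signed sum over s into the
    determinant of a matrix obtained by selecting columns of X, which is
    det X times the determinant of the selection. *)
Lemma capelli_coord (E y : 'I_m -> 'M[R]_n) :
  exists kappa, forall X : 'M[R]_m,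
    capelli (fun i => \sum_e X i e *: E e) y = \det X *: kappa.
Proof.
exists (\sum_(h : {ffun 'I_m -> 'I_m})
   \det (\matrix_(k, e) (h k == e)%:R : 'M[R]_m) *: \prod_k (E (h k) * y k)).
move=> X; rewrite /capelli scaler_sumr.
transitivity (\sum_(s : 'S_m) \sum_(h : {ffun 'I_m -> 'I_m})
   ((-1) ^+ s * \prod_k X (s k) (h k)) *: \prod_k (E (h k) * y k)).
  apply: eq_bigr => s _.
  transitivity ((-1) ^+ s *: \prod_k \sum_e (X (s k) e *: (E e * y k))).
    congr (_ *: _); apply: eq_bigr => k _.
    by rewrite mulr_suml; apply: eq_bigr => e _; rewrite scalerAl.
  rewrite bigA_distr_bigA scaler_sumr; apply: eq_bigr => h _.
  by rewrite scaler_prod scalerA.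
(* For each choice h of basis elements, the sum over s is the determinant of
   the columns of X selected by h. *)
rewrite exchange_big; apply: eq_bigr => h _ /=.
rewrite -scaler_suml scalerA; congr (_ *: _).
rewrite [RHS]mulrC -(det_tr X) -det_mulmx.
apply: eq_bigr => s _; congr (_ * _); apply: eq_bigr => k _.
rewrite mxE (bigD1 (h k)) //= !mxE eqxx mul1r big1 ?addr0 // => e ne.
by rewrite !mxE eq_sym (negbTE ne) mul0r.
Qed.

End Capelli.

Section MapCapelli.
Variables (R S : comNzRingType) (f : {rmorphism R -> S}) (n' m : nat).

Lemma map_capelli (x y : 'I_m -> 'M[R]_n'.+1) :
  map_mx f (capelli x y) =
  capelli (fun i => map_mx f (x i)) (fun i => map_mx f (y i)).
Proof.
rewrite /capelli rmorph_sum; apply: eq_bigr => s _ /=.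
rewrite map_mxZ rmorphXn rmorphN1 rmorph_prod; congr (_ *: _).
by apply: eq_bigr => k _; rewrite rmorphM.
Qed.
End MapCapelli.

Section CapelliMul.
Variables (R : comNzRingType) (n' : nat).
Local Notation n := n'.+1.
Local Notation m := (\sum_(i < n) n)%N.
Implicit Types x y : 'I_m -> 'M[R]_n.

Lemma det_castmx p q (e e' : p = q) (A : 'M[R]_p) :
  \det (castmx (e, e') A) = \det A.
Proof. by case: q / e e' => e'; rewrite (eq_irrelevance e' erefl) castmx_id. Qed.

Lemma det_mxdiag_const p q (a : 'M[R]_q) : \det (\mxdiag_(i < p) a) = \det a ^+ p.
Proof.
elim: p => [|p IHp]; last by rewrite mxdiag_recl det_castmx det_ublock IHp exprS.
rewrite expr0; move: (\mxdiag_(_ < 0) a); rewrite big_ord0 => A.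
exact: det_mx00.
Qed.

Lemma sum_sig p q (F : 'I_p -> 'I_q -> 'M[R]_n) :
  \sum_(e < \sum_(i < p) q) F (tagnat.sig1 e) (tagnat.sig2 e) =
  \sum_i \sum_j F i j.
Proof.
rewrite (@sig_big_dep _ _ _ _ (fun=> 'I_q : finType) xpredT (fun _ => xpredT)) /=.
by rewrite (reindex _ tagnat.sig_bij_on).
Qed.

(* Matrices are flattened row by row, so that right multiplication becomes
   block diagonal. *)
Let vec (w : 'M[R]_n) : 'rV[R]_m := \mxrow_(i < n) row i w.
Let unit_mx (e : 'I_m) : 'M[R]_n := delta_mx (tagnat.sig1 e) (tagnat.sig2 e).

Let vec_sum w : w = \sum_e vec w 0 e *: unit_mx e.
Proof.
rewrite {1}(matrix_sum_delta w) -sum_sig; apply: eq_bigr => e _.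
by rewrite !mxE.
Qed.

Let vecM w a : vec (w *m a) = vec w *m \mxdiag_(i < n) a.
Proof.
by rewrite mul_mxrow_mxdiag; apply: eq_mxrow => i; rewrite row_mul.
Qed.

(** Row after row, right multiplication by a acts on the coordinates of x as n
    diagonal blocks a; hence the exponent n. *)
Lemma capelli_mulr x y a :
  capelli (fun i => x i * a) y = \det a ^+ n *: capelli x y.
Proof.
have [kappa kappaE] := capelli_coord unit_mx y.
pose X : 'M_m := \matrix_i vec (x i).
rewrite (@eq_capelli _ _ _ x (fun i => \sum_e X i e *: unit_mx e)); last first.
  by move=> i; rewrite {1}(vec_sum (x i)); apply: eq_bigr => e _; rewrite !mxE.
rewrite (@eq_capelli _ _ _ (fun i => _ * a)
   (fun i => \sum_e (X *m \mxdiag_(i < n) a) i e *: unit_mx e)); last first.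
  move=> i; rewrite {1}(vec_sum (x i * a)) vecM; apply: eq_bigr => e _.
  by congr (_ *: _); rewrite !mxE; apply: eq_bigr => k _; rewrite !mxE.
by rewrite !kappaE det_mulmx det_mxdiag_const scalerA mulrC.
Qed.

(** Left multiplication by a is right multiplication by its transpose on
    transposed matrices, so the transposed matrix units are used as a basis. *)
Lemma capelli_mull x y a :
  capelli (fun i => a * x i) y = \det a ^+ n *: capelli x y.
Proof.
have [kappa kappaE] := capelli_coord (fun e => (unit_mx e)^T) y.
pose X : 'M_m := \matrix_i vec (x i)^T.
rewrite (@eq_capelli _ _ _ x (fun i => \sum_e X i e *: (unit_mx e)^T)); last first.
  move=> i; rewrite -{1}(trmxK (x i)) {1}(vec_sum (x i)^T) raddf_sum.
  by apply: eq_bigr => e _ /=; rewrite linearZ /= !mxE.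
rewrite (@eq_capelli _ _ _ (fun i => a * _)
   (fun i => \sum_e (X *m \mxdiag_(i < n) a^T) i e *: (unit_mx e)^T)); last first.
  move=> i; rewrite -{1}(trmxK (a * x i)) trmx_mul {1}(vec_sum (_ *m _)) vecM.
  rewrite raddf_sum; apply: eq_bigr => e _ /=; rewrite linearZ /=.
  by congr (_ *: _); rewrite !mxE; apply: eq_bigr => k _; rewrite !mxE.
by rewrite !kappaE det_mulmx det_mxdiag_const det_tr scalerA mulrC.
Qed.
End CapelliMul.

(** Row vectors that are successively mapped to multiples of each other let an
    ordered product of matrices be evaluated without expanding its entries. *)
Lemma row_mul_prod (R : comNzRingType) n m (v : nat -> 'rV[R]_n.+1) (c : 'I_m -> R)
    (M : 'I_m -> 'M[R]_n.+1) :
  (forall k : 'I_m, v k *m M k = c k *: v k.+1) ->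
  v 0%N *m \prod_k M k = \prod_k c k *: v m.
Proof.
elim: m v c M => [|m IHm] v c M vM; first by rewrite !big_ord0 mulmx1 scale1r.
rewrite !big_ord_recl /= mulmxA (vM ord0) -scalemxAl.
by rewrite (IHm (v \o succn) (c \o lift ord0)) ?scalerA // => k; apply: (vM (lift ord0 k)).
Qed.

Section CapelliUnits.
Variables (R : comNzRingType) (n' : nat).
Local Notation n := n'.+1.
Local Notation m := (\sum_(i < n) n)%N.

(** The row index of the j-th matrix unit.  It must also make sense for j = m,
    the successor of the last index, where any value would do. *)
Definition row_at (j : nat) : 'I_n :=
  if insub j is Some e then tagnat.sig1 (e : 'I_m) else ord0.

(** The factor y_k links the column of the k-th matrix unit to the row of the
    next one, so the summand of s vanishes on the first row vector unless
    s k = k for all k: only the identity permutation survives. *)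
Lemma capelli_units_neq0 :
  capelli (fun e : 'I_m => delta_mx (tagnat.sig1 e) (tagnat.sig2 e) : 'M[R]_n)
     (fun e : 'I_m => delta_mx (tagnat.sig2 e) (row_at e.+1)) != 0.
Proof.
have row_atE (e : 'I_m) : row_at e = tagnat.sig1 e by rewrite /row_at valK.
have sigI (e e' : 'I_m) : tagnat.sig1 e = tagnat.sig1 e' ->
    tagnat.sig2 e = tagnat.sig2 e' :> 'I_n -> e = e'.
  move=> e1 e2; apply: tagnat.sig_inj; rewrite !tagnat.sigE12.
  move: (tagnat.sig1 e) (tagnat.sig2 e) (tagnat.sig1 e') (tagnat.sig2 e') e1 e2.
  by move=> i j i' j' /= <- <-.
pose v j : 'rV[R]_n := delta_mx 0 (row_at j).
(* The k-th factor of the identity summand maps v k to v k.+1. *)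
suff vE : v 0%N *m capelli (fun e : 'I_m => delta_mx (tagnat.sig1 e) (tagnat.sig2 e))
     (fun e : 'I_m => delta_mx (tagnat.sig2 e) (row_at e.+1)) = v m.
  apply/eqP => c0; move: vE; rewrite c0 mulmx0 => /rowP/(_ (row_at m))/eqP.
  by rewrite !mxE !eqxx eq_sym oner_eq0.
rewrite mulmx_sumr (bigD1 (1%g : 'S_m)) //= [X in _ + X]big1 => [|s s_neq1].
  rewrite addr0 odd_perm1 expr0 scale1r (@row_mul_prod _ _ _ v (fun=> 1)).
    by rewrite big1 ?scale1r.
  move=> k; rewrite perm1 /v row_atE -mulmxE mulmxA !mul_delta_mx.
  by rewrite scale1r.
rewrite -scalemxAr (@row_mul_prod _ _ _ v (fun k => (s k == k)%:R)) => [|k].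
  have [k sk] : exists k, s k != k.
    apply/existsP; rewrite -negb_forall; apply: contra s_neq1 => /forallP s1.
    by apply/eqP/permP => k; rewrite perm1; apply/eqP.
  by rewrite (bigD1 k) //= (negbTE sk) mul0r scale0r scaler0.
rewrite /v row_atE -mulmxE !(mulmxA, mul_delta_mx_cond).
have [-> | /eqP sk] := eqVneq (s k) k.
  by rewrite !eqxx mul_delta_mx_cond eqxx scale1r.
rewrite scale0r; case: eqP => [e1 | _]; last by rewrite mulr0n mul0mx.
rewrite mulr1n mul_delta_mx_cond; case: eqP => // e2.
by case: sk; apply: sigI; rewrite -?e1.
Qed.
End CapelliUnits.

(** * A conductor for subrings of matrices *)

Section Conductor.
Variables (R : comNzRingType) (n' : nat).
Local Notation n := n'.+1.
Local Notation m := (\sum_(i < n) n)%N.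
Variable A : 'M[R]_n -> Prop.
Hypothesis subA : is_subring A.

Definition coef_mx k (M : 'M[{poly R}]_n) : 'M[R]_n := map_mx (coefp k) M.

(** The matrices whose coefficients in t lie in A: the copy of A[t] inside
    matrices over R[t]. *)
Definition poly_closure (M : 'M[{poly R}]_n) : Prop := forall k, A (coef_mx k M).

Lemma coef_mxM k M N :
  coef_mx k (M * N) = \sum_(i < k.+1) coef_mx i M * coef_mx (k - i) N.
Proof.
apply/matrixP => i j; rewrite summxE !mxE /= coef_sum.
transitivity (\sum_l \sum_(d < k.+1) (M i l)`_d * (N l j)`_(k - d)).
  by apply: eq_bigr => l _; rewrite coefM.
rewrite exchange_big; apply: eq_bigr => d _; rewrite mxE.
by apply: eq_bigr => l _; rewrite !mxE.
Qed.

Lemma coef_mxC k (a : 'M[R]_n) : coef_mx k (map_mx polyC a) = if k == 0%N then a else 0.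
Proof.
by apply/matrixP => i j; rewrite !mxE /= coefC; case: ifP; rewrite // mxE.
Qed.

Lemma poly_closureC a : A a -> poly_closure (map_mx polyC a).
Proof. by move=> Aa k; rewrite coef_mxC; case: ifP => // _; apply: subring0 subA. Qed.

Lemma poly_closure_subring : is_subring poly_closure.
Proof.
split.
- rewrite -(rmorph1 (map_mx polyC)); exact/poly_closureC/(subring1 subA).
- move=> M N PM PN k; rewrite (_ : coef_mx k _ = coef_mx k M - coef_mx k N).
    exact: subringB.
  by apply/matrixP => i j; rewrite !mxE /= coefB.
- move=> M N PM PN k; rewrite coef_mxM; apply: subring_sum => // i _.
  exact: subringM.
Qed.

Lemma poly_closureX a : A a -> poly_closure ('X *: map_mx polyC a).
Proof.
move=> Aa k; rewrite (_ : coef_mx k _ = if k == 1%N then a else 0).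
  by case: ifP => // _; apply: subring0 subA.
apply/matrixP => i j; rewrite !mxE /= coefXM coefC.
by case: k => [|[|k]] /=; rewrite ?mxE.
Qed.

Lemma capelli_subring m' (x y : 'I_m' -> 'M[R]_n) :
  (forall e, A (x e)) -> (forall e, A (y e)) -> A (capelli x y).
Proof.
move=> Ax Ay; apply: capelli_ind => [|a b|s]; first exact: subring0.
  exact: subringB.
by apply: subring_prod => // k _; apply: subringM.
Qed.

(** The reverse of the characteristic polynomial: its coefficient of degree k
    is (-1)^k xi_k(a). *)
Definition revdet (a : 'M[R]_n) : {poly R} := \det (1 - 'X *: map_mx polyC a).

Variables (S : comNzRingType) (f : {rmorphism R -> S}).
Hypothesis units : forall i j, exists2 a, A a & map_mx f a = delta_mx i j.

(** Lifting the matrix units along f gives a nonvanishing Capelli sum with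
    entries in A.  Its last y can be replaced by 1: that factor ends every
    summand, so the original sum is the new one times it.  A product of
    x_k * a and y_k then ends with a, as membership in Aa requires. *)
Lemma capelli_values : exists x y : 'I_m -> 'M[R]_n,
  [/\ forall e, A (x e), forall e, A (y e), forall e : 'I_m, e.+1 = m -> y e = 1 &
      capelli x y != 0].
Proof.
have choose (p q : 'I_m -> 'I_n) : exists x : 'I_m -> 'M[R]_n,
    forall e, A (x e) /\ map_mx f (x e) = delta_mx (p e) (q e).
  apply: (@fin_all_exists _ _ (fun e x => A x /\ map_mx f x = delta_mx (p e) (q e))).
  by move=> e; have [a] := units (p e) (q e); exists a.
have [x xP] := choose tagnat.sig1 tagnat.sig2.
have [y yP] := choose tagnat.sig2 (fun e => row_at n' e.+1).
have xy_neq0 : capelli x y != 0.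
  apply/eqP => /(congr1 (map_mx f)) /eqP; rewrite map_capelli map_mx0.
  apply/negP; have := capelli_units_neq0 S n'; congr (~~ (_ == _)).
  apply: eq_bigr => s _; congr (_ *: _); apply: eq_bigr => k _.
  by rewrite (proj2 (xP _)) (proj2 (yP _)).
exists x, (fun e : 'I_m => if e.+1 == m then 1 else y e); split.
- by move=> e; case: (xP e).
- by move=> e; case: ifP => _; [apply: (subring1 subA) | case: (yP e)].
- by move=> e ->; rewrite eqxx.
have m_gt0 : (0 < m)%N by rewrite big_ord_recl.
clear xP yP; move: x y m_gt0 xy_neq0; case: (m) => // m0 x y _.
apply: contra_neq => xy0.
rewrite -[RHS](mul0r (y ord_max)) -xy0 /capelli mulr_suml.
apply: eq_bigr => s _; rewrite -scalerAl; congr (_ *: _).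
rewrite !big_ord_recr /= eqxx mulr1 mulrA; congr (_ * _ * _).
by apply: eq_bigr => k _; rewrite eqSS ltn_eqF.
Qed.

(** The element u is a Capelli sum.  Its multiples by det(a)^n are Capelli sums
    with a multiplied into every x_k: on the left each summand starts with a,
    on the right it ends with a.  For the coefficients, the same identity is
    used over R[t] with 1 - ta in place of a. *)
Lemma conductor : exists u : 'M[R]_n,
  [/\ A u, u != 0 & forall a, A a ->
     [/\ exists2 w, A w & \det a ^+ n *: u = a * w,
         exists2 w, A w & \det a ^+ n *: u = w * a &
         forall k, A ((revdet a ^+ n)`_k *: u)]].
Proof.
have [x [y [Ax Ay y1 u0]]] := capelli_values.
exists (capelli x y); split=> // [|a Aa]; first exact: capelli_subring.
split.
- rewrite -capelli_mull.
  apply: (@capelli_ind _ _ _ _ _ (fun z => exists2 w, A w & z = a * w)).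
  + by exists 0; rewrite ?mulr0 //; apply: subring0 subA.
  + move=> _ _ [w Aw ->] [w' Aw' ->]; exists (w - w'); rewrite ?mulrBr //.
    exact: subringB.
  move=> s; have : (0 < m)%N by rewrite big_ord_recl.
  move: (x) (y) Ax Ay s; case: (m) => // m0 x0 y0 Ax0 Ay0 s _.
  exists (x0 (s ord0) * y0 ord0 * \prod_(i < m0)
            (a * x0 (s (lift ord0 i)) * y0 (lift ord0 i))); last first.
    by rewrite big_ord_recl !mulrA.
  apply: subringM => //; first exact: subringM.
  by apply: subring_prod => // i _; apply: subringM => //; apply: subringM.
- rewrite -capelli_mulr.
  apply: (@capelli_ind _ _ _ _ _ (fun z => exists2 w, A w & z = w * a)).
  + by exists 0; rewrite ?mul0r //; apply: subring0 subA.
  + move=> _ _ [w Aw ->] [w' Aw' ->]; exists (w - w'); rewrite ?mulrBl //.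
    exact: subringB.
  move=> s; have : (0 < m)%N by rewrite big_ord_recl.
  move: (x) (y) Ax Ay y1 s; case: (m) => // m0 x0 y0 Ax0 Ay0 y01 s _.
  rewrite big_ord_recr /= (y01 ord_max) // mulr1 mulrA.
  eexists; last by [].
  apply: subringM => //.
  by apply: subring_prod => // i _; apply: subringM => //; apply: subringM.
move=> k.
have := @capelli_mulr _ _ (fun i => map_mx polyC (x i)) (fun i => map_mx polyC (y i))
   (1 - 'X *: map_mx polyC a).
rewrite -map_capelli -/(revdet a) => eq_cap.
rewrite (_ : _ *: _ = coef_mx k (revdet a ^+ n *: map_mx polyC (capelli x y))); last first.
  by apply/matrixP => i j; rewrite !mxE /= coefMC.
rewrite -eq_cap; have subP := poly_closure_subring; move: k.
apply: (@capelli_ind _ _ _ _ _ poly_closure); first exact: (subring0 subP).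
  exact: (subringB subP).
move=> s; apply: (subring_prod subP) => i _.
apply: (subringM subP); last exact: poly_closureC.
apply: (subringM subP); first exact: poly_closureC.
by apply: (subringB subP); [apply: subring1 subP | apply: poly_closureX].
Qed.
End Conductor.

(** * Characteristic coefficients *)

(** Two factorizations of the block matrix with rows (1, -Y) and (X, 1). *)
Lemma det_1D_mulC (R : comNzRingType) p q (X : 'M[R]_(p, q)) (Y : 'M[R]_(q, p)) :
  \det (1%:M + X *m Y) = \det (1%:M + Y *m X).
Proof.
pose M := block_mx 1%:M (- Y) X (1%:M : 'M_p).
have : \det M = \det (1%:M + X *m Y).
  have -> : M = block_mx 1%:M 0 X 1%:M *m block_mx 1%:M (- Y) 0 (1%:M + X *m Y).
    rewrite mulmx_block !(mul1mx, mul0mx, mulmx0, mulmx1, addr0) mulmxN.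
    by rewrite addrCA addNr addr0.
  by rewrite det_mulmx det_lblock det_ublock !det1 !mul1r.
have -> : M = block_mx 1%:M (- Y) 0 1%:M *m block_mx (1%:M + Y *m X) 0 X 1%:M.
  rewrite mulmx_block !(mul1mx, mul0mx, mulmx0, mulmx1, add0r) mulNmx.
  by rewrite addrK.
by rewrite det_mulmx det_lblock det_ublock !det1 !mul1r !mulr1.
Qed.

Section PrincipalMinors.
Variables (R : comNzRingType) (n : nat).
Implicit Types (A B : 'M[R]_n) (I : {set 'I_n}).

Definition principal_minor I A : R :=
  \det (mxsub (fun i : 'I_#|I| => enum_val i) (fun j : 'I_#|I| => enum_val j) A).

(** With P the inclusion of the rows I, the matrix on the right is
    1 + P (P^T (A - 1)), so exchanging the factors leaves P^T A P. *)
Lemma principal_minorE I A :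
  principal_minor I A = \det (\matrix_(i, j) if i \in I then A i j else (i == j)%:R).
Proof.
pose P : 'M[R]_(n, #|I|) := \matrix_(i, k) (i == enum_val k)%:R.
have PE q (C : 'M[R]_(n, q)) : mxsub (fun i : 'I_#|I| => enum_val i) id C = P^T *m C.
  apply/matrixP => i j; rewrite !mxE (bigD1 (enum_val i)) //= !mxE eqxx mul1r.
  by rewrite big1 ?addr0 // => l /negbTE nl; rewrite !mxE nl mul0r.
(* Outside I this matrix is the identity, and left multiplication by P^T
   selects the rows of index in I. *)
have -> : (\matrix_(i, j) if i \in I then A i j else (i == j)%:R) =
   1%:M + P *m (P^T *m (A - 1%:M)).
  rewrite -PE; apply/matrixP => i j; rewrite !mxE.
  case: ifP => [iI | iI].
    rewrite (bigD1 (enum_rank_in iI i)) //= !mxE enum_rankK_in // eqxx mul1r.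
    rewrite big1 ?addr0 => [|l ne]; first by rewrite addrC subrK.
    rewrite !mxE; case: eqP => [il | _]; last by rewrite mul0r.
    by case/eqP: ne; apply: enum_val_inj; rewrite enum_rankK_in.
  rewrite big1 ?addr0 // => l _; rewrite !mxE; case: eqP => [il | _]; last by rewrite mul0r.
  by have := enum_valP l; rewrite -il iI.
rewrite det_1D_mulC mulmxBr mulmxBl mulmx1.
have -> : P^T *m P = 1%:M.
  rewrite -PE; apply/matrixP => i j; rewrite !mxE.
  by rewrite (inj_eq enum_val_inj).
rewrite addrC subrK -PE; congr (\det _); apply/matrixP => i j; rewrite !mxE.
rewrite (bigD1 (enum_val j)) //= !mxE eqxx mulr1.
by rewrite big1 ?addr0 // => l /negbTE nl; rewrite !mxE nl mulr0.
Qed.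

(** Each row of 1 + B is a sum of two rows; I records the rows where the
    second one is chosen. *)
Lemma det_1D B : \det (1 + B) = \sum_I principal_minor I B.
Proof.
rewrite addrC /determinant; under eq_bigr => s _.
  under eq_bigr => i _ do rewrite mxE.
  rewrite bigA_distr mulr_sumr; over.
rewrite exchange_big; apply: eq_bigr => I _ /=.
rewrite principal_minorE; apply: eq_bigr => s _; congr (_ * _).
by apply: eq_bigr => i _; rewrite !mxE.
Qed.

(** A principal minor of order 1 is a diagonal entry. *)
Lemma char_coef1 A : char_coef 1 A = \tr A.
Proof.
rewrite /char_coef /mxtrace.
transitivity (\sum_(I : {set 'I_n} | #|I| == 1%N) \sum_(i in I) A i i).
  apply: eq_bigr => I /eqP I1; rewrite big_enum_val /=.
  set M := mxsub _ _ A.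
  transitivity (\tr M); last by apply: eq_bigr => k _; rewrite mxE.
  move: M; rewrite I1 => M.
  by rewrite det_mx11 /mxtrace big_ord1.
transitivity (\sum_i \sum_(I : {set 'I_n} | I == [set i]) A i i); last first.
  by apply: eq_bigr => i _; rewrite big_pred1_eq.
rewrite (exchange_big_dep (fun I : {set 'I_n} => #|I| == 1%N)) /=; last first.
  by move=> i I _ /eqP ->; rewrite cards1.
apply: eq_bigr => I /cards1P [i ->]; apply: eq_bigl => j.
by rewrite inE eq_sym (inj_eq set1_inj).
Qed.

End PrincipalMinors.

Section RevDet.
Variables (R : comNzRingType) (n' : nat).
Lemma coef_revdet (a : 'M[R]_n'.+1) k : (revdet a)`_k = (-1) ^+ k * char_coef k a.
Proof.
rewrite /revdet -scaleNr det_1D coef_sum /char_coef mulr_sumr [RHS]big_mkcond.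
apply: eq_bigr => I _; rewrite /principal_minor.
have -> : mxsub (fun i : 'I_#|I| => enum_val i) (fun j : 'I_#|I| => enum_val j)
     (- 'X *: map_mx polyC a) = - 'X *: map_mx polyC (mxsub enum_val enum_val a).
  by apply/matrixP => i j; rewrite !mxE.
rewrite detZ det_map_mx (exprNn 'X).
have -> : (-1) ^+ #|I| = ((-1) ^+ #|I|)%:P :> {poly R} by rewrite rmorphXn rmorphN1.
rewrite -mulrA coefCM coefXnM coefC.
rewrite subn_eq0; case: ltngtP => [|_|->]; rewrite ?mulr0 //.
Qed.

Lemma coef0_revdet (a : 'M[R]_n'.+1) : (revdet a)`_0 = 1.
Proof.
rewrite -horner_coef0 -[LHS]/(horner_eval 0 (revdet a)) /revdet -det_map_mx.
have -> : map_mx (horner_eval 0) (1 - 'X *: map_mx polyC a) = 1%:M.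
  apply/matrixP => i j; rewrite !mxE /horner_eval hornerD hornerN hornerM hornerX.
  by rewrite mul0r subr0 hornerMn hornerC.
exact: det1.
Qed.

End RevDet.

Section PolyRoot.
Variables (F : comNzRingType) (Z : F -> Prop).
Hypothesis subZ : is_subring Z.

Lemma coef_exprn_subring (q : {poly F}) n :
  (forall k, Z q`_k) -> forall k, Z (q ^+ n)`_k.
Proof.
move=> Zq; elim: n => [|n IHn] k.
  rewrite expr0 coef1; case: (k == 0)%N; [exact: subring1 | exact: subring0].
rewrite exprS coefM; apply: subring_sum => // i _; exact: subringM.
Qed.

Lemma exprDn_mod_sqr (q e : {poly F}) n :
  exists h, (q + e) ^+ n = q ^+ n + (q ^+ n.-1 *+ n) * e + h * e ^+ 2.
Proof.
case: n => [|n]; first by exists 0; rewrite !expr0 mulr0n !mul0r !addr0.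
exists (\sum_(i < n) (q ^+ (n.+1 - i.+2) * e ^+ i) *+ 'C(n.+1, i.+2)).
rewrite exprDn !big_ord_recl /= subn0 expr0 mulr1 bin0 subn1 expr1 bin1 addrA.
rewrite mulrnAl; congr (_ + _); rewrite mulr_suml; apply: eq_bigr => i _.
by rewrite mulrnAl -mulrA -exprD addn2.
Qed.

(** By induction on the degree: in degree k > 0 the coefficient of q^n is
    n * q_k plus an expression in q_1, ..., q_(k-1), because q_0 = 1; and the
    inverse of n lies in Z. *)
Lemma coef_root_subring (q : {poly F}) n :
  (exists2 c, Z c & c * n%:R = 1) -> q`_0 = 1 ->
  (forall k, Z (q ^+ n)`_k) -> forall k, Z q`_k.
Proof.
move=> [c Zc cn] q0 Zqn; elim/ltn_ind => -[|k] IHk; first by rewrite q0; apply: subring1.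
(* The square of the part of q of degree > k starts in degree 2 (k + 1). *)
pose r := take_poly k.+1 q; pose g := drop_poly k.+1 q.
have Zr i : Z r`_i.
  by rewrite coef_take_poly; case: ifP => [/IHk //|_]; apply: subring0.
have [h] := exprDn_mod_sqr r (g * 'X^(k.+1)) n.
rewrite poly_take_drop => /(congr1 (fun p : {poly F} => p`_k.+1)).
rewrite !coefD mulrA coefMXn ltnn subnn exprMn -exprM mulrA coefMXn.
rewrite -{3}[k.+1]muln1 ltn_pmul2l // addr0 coef0M coefMn.
have -> : (r ^+ n.-1)`_0 = 1.
  by rewrite -horner_coef0 horner_exp horner_coef0 coef_take_poly q0 expr1n.
rewrite coef_drop_poly add0n => qn.
have -> : q`_k.+1 = c * ((q ^+ n)`_k.+1 - (r ^+ n)`_k.+1).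
  by rewrite qn addrC addKr mulrA cn mul1r.
by apply: subringM => //; apply: subringB => //; apply: coef_exprn_subring.
Qed.
End PolyRoot.

(** * Ore localization *)

Section OreLocalization.
Variables (U : unitRingType) (A : U -> Prop).
Hypothesis subA : is_subring A.
Hypothesis unitA : forall a, A a -> a != 0 -> a \is a GRing.unit.
Hypothesis right_ore : forall a s, A a -> A s -> s != 0 ->
  exists b t, [/\ A b, A t, t != 0 & a * t = s * b].
Hypothesis left_ore : forall a s, A a -> A s -> s != 0 ->
  exists b t, [/\ A b, A t, t != 0 & t * a = b * s].

Definition right_fractions : U -> Prop :=
  fun d => exists a s, [/\ A a, A s, s != 0 & d = a / s].

(** The right Ore condition gives common denominators and moves denominators
    across numerators, hence the ring structure on right fractions; the left
    Ore condition rewrites them as left fractions. *)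
Lemma right_fractionsP : is_skew_field_of_fractions A right_fractions.
Proof.
have mul_neq0 a b : A a -> A b -> a != 0 -> b != 0 -> a * b != 0.
  move=> Aa Ab a0 b0; apply/eqP => ab0; case/eqP: b0.
  by rewrite -[b](mulKr (unitA Aa a0)) ab0 mulr0.
have invP a : A a -> a != 0 -> is_inverse a a^-1.
  by move=> Aa a0; split; [apply: mulrV | apply: mulVr]; apply: unitA.
have A1 := subring1 subA.
have DA a : A a -> right_fractions a.
  by exists a, 1; rewrite oner_neq0 divr1.
have subD : is_subring right_fractions.
  split; first exact: DA.
  - move=> _ _ [a [s [Aa As s0 ->]]] [b [r [Ab Ar r0 ->]]].
    have [c [t [Ac At t0 st]]] := right_ore As Ar r0.
    exists (a * t - b * c), (s * t); split.
    + by apply: (subringB subA); apply: (subringM subA).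
    + exact: (subringM subA).
    + exact: mul_neq0.
    have ust : s * t \is a GRing.unit.
      by apply: unitA; [apply: (subringM subA) | apply: mul_neq0].
    rewrite mulrBl; congr (_ - _).
      apply: (mulIr ust); rewrite /= mulrVK // mulrA mulrVK //; exact: unitA.
    apply: (mulIr ust); rewrite /= mulrVK // st mulrA mulrVK //; exact: unitA.
  move=> _ _ [a [s [Aa As s0 ->]]] [b [r [Ab Ar r0 ->]]].
  have [c [t [Ac At t0 bt]]] := right_ore Ab As s0.
  exists (a * c), (r * t); split; try exact: (subringM subA).
    exact: mul_neq0.
  have us := unitA As s0; have ur := unitA Ar r0; have ut := unitA At t0.
  have urt : r * t \is a GRing.unit by rewrite unitrMl.
  by apply: (mulIr urt); rewrite /= mulrVK // -!mulrA (mulKr ur) bt mulKr.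
split.
  split=> // [|_ [a [s [Aa As s0 ->]]] /eqP as0]; first by apply/eqP/oner_neq0.
  have a0 : a != 0 by apply: contraNneq as0 => ->; rewrite mul0r.
  have us := unitA As s0; have ua := unitA Aa a0.
  exists (s / a); first by exists s, a.
  by split; rewrite mulrA mulrVK ?divrr.
split=> // [u [Au /eqP u0]|_ [a [s [Aa As s0 ->]]]|_ [a [s [Aa As s0 ->]]]].
- exists u^-1; last exact: invP.
  by exists 1, u; rewrite div1r.
- exists a, s, s^-1; split=> //; last exact: invP.
  by split=> //; apply/eqP.
have [b [t [Ab At t0 ta]]] := left_ore Aa As s0.
exists b, t, t^-1; split=> //; last 2 first.
- exact: invP.
- have us := unitA As s0; have ut := unitA At t0.
  by apply: (mulrI ut); rewrite mulVKr // mulrA ta mulrK.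
by split=> //; apply/eqP.
Qed.
End OreLocalization.

(** Fractions over A are fractions over B, and the inverses of nonzero elements
    of B exist in D because D is a skew field. *)
Lemma skew_field_of_fractions_between (R : pzRingType) (A B D : R -> Prop) :
  (forall a, A a -> B a) -> (forall b, B b -> D b) ->
  is_skew_field_of_fractions A D -> is_skew_field_of_fractions B D.
Proof.
move=> AB BD [skewD [subD _ _ fracr fracl]]; split=> //.
have nz u : nonzero A u -> nonzero B u by case=> /AB.
split=> // [u [/BD Du u0] | d /fracr | d /fracl].
- by case: skewD => _ _ /(_ u Du u0).
- by case=> a [u [v [/AB ? /nz ? ? ?]]]; exists a, u, v.
- by case=> a [u [v [/AB ? /nz ? ? ?]]]; exists a, u, v.
Qed.

Section FractionField.
Variables (R : idomainType) (n' : nat).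
Local Notation n := n'.+1.
Local Notation iota := (map_mx (@tofrac R)).
Variable A : 'M[R]_n -> Prop.
Hypothesis subA : is_subring A.
Hypothesis det_neq0 : forall a, A a -> a != 0 -> \det a != 0.
Variable u : 'M[R]_n.
Hypotheses (Au : A u) (u0 : u != 0).
Hypothesis condu : forall a, A a ->
  [/\ exists2 w, A w & \det a ^+ n *: u = a * w,
      exists2 w, A w & \det a ^+ n *: u = w * a &
      forall k, A ((revdet a ^+ n)`_k *: u)].

Lemma subring_mul_neq0 a b : A a -> A b -> a != 0 -> b != 0 -> a * b != 0.
Proof.
move=> Aa Ab a0 b0; apply/eqP => ab0.
have : \det (a * b) != 0 by rewrite detM mulf_neq0 ?det_neq0.
by rewrite ab0 det0 eqxx.
Qed.

Lemma common_multiple_neq0 a s : A a -> A s -> a != 0 -> s != 0 ->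
  (\det a ^+ n * \det s ^+ n) *: (u * u) != 0.
Proof.
move=> Aa As a0 s0; rewrite scalemx_eq0 negb_or mulf_neq0 ?expf_neq0 ?det_neq0 //.
exact: subring_mul_neq0.
Qed.

(** With det(a)^n u = a w and det(s)^n u = s w', the product
    a w s w' = s w' a w is a common right multiple, the determinants being
    scalars. *)
Lemma conductor_right_ore a s : A a -> A s -> s != 0 ->
  exists b t, [/\ A b, A t, t != 0 & a * t = s * b].
Proof.
move=> Aa As s0; have [-> | a0] := eqVneq a 0.
  exists 0, 1; rewrite mul0r mulr0 oner_neq0; split=> //.
    exact: subring0 subA.
  exact: subring1 subA.
have [[w Aw wE] _ _] := condu Aa; have [[w' Aw' wE'] _ _] := condu As.
have aw_sw : a * w * (s * w') = (\det a ^+ n * \det s ^+ n) *: (u * u).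
  by rewrite -wE -wE' -scalerAl -scalerAr scalerA.
have sw_aw : s * w' * (a * w) = (\det a ^+ n * \det s ^+ n) *: (u * u).
  by rewrite -wE -wE' -scalerAl -scalerAr scalerA mulrC.
exists (w' * (a * w)), (w * (s * w')); split.
- by do 2?apply: (subringM subA).
- by do 2?apply: (subringM subA).
- apply: contraNneq (common_multiple_neq0 Aa As a0 s0) => t0.
  by rewrite -aw_sw -mulrA t0 mulr0.
by rewrite !mulrA in aw_sw sw_aw *; rewrite aw_sw sw_aw.
Qed.

(** The mirror image: w a w' s = w' s w a is a common left multiple. *)
Lemma conductor_left_ore a s : A a -> A s -> s != 0 ->
  exists b t, [/\ A b, A t, t != 0 & t * a = b * s].
Proof.
move=> Aa As s0; have [-> | a0] := eqVneq a 0.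
  exists 0, 1; rewrite mul0r mulr0 oner_neq0; split=> //.
    exact: subring0 subA.
  exact: subring1 subA.
have [_ [w Aw wE] _] := condu Aa; have [_ [w' Aw' wE'] _] := condu As.
have wa_ws : w * a * (w' * s) = (\det a ^+ n * \det s ^+ n) *: (u * u).
  by rewrite -wE -wE' -scalerAl -scalerAr scalerA.
have ws_wa : w' * s * (w * a) = (\det a ^+ n * \det s ^+ n) *: (u * u).
  by rewrite -wE -wE' -scalerAl -scalerAr scalerA mulrC.
exists (w * a * w'), (w' * s * w); split.
- by do 2?apply: (subringM subA).
- by do 2?apply: (subringM subA).
- apply: contraNneq (common_multiple_neq0 Aa As a0 s0) => t0.
  by rewrite -ws_wa mulrA t0 mul0r.
by rewrite !mulrA in wa_ws ws_wa *; rewrite wa_ws ws_wa.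
Qed.

Definition frac_image (z : 'M[{fraction R}]_n) : Prop := exists2 a, A a & z = iota a.
Definition frac_field : 'M[{fraction R}]_n -> Prop := right_fractions frac_image.

Lemma tofrac_mx_eq0 (a : 'M[R]_n) : (iota a == 0) = (a == 0).
Proof.
apply/eqP/eqP => [/matrixP a0 | ->]; last exact: map_mx0.
apply/matrixP => i j; have /eqP := a0 i j.
by rewrite !mxE tofrac_eq0 => /eqP.
Qed.

Lemma frac_image_subring : is_subring frac_image.
Proof.
split; first by exists 1; [apply: subring1 subA | rewrite rmorph1].
  move=> _ _ [a Aa ->] [b Ab ->]; exists (a - b); last by rewrite rmorphB.
  exact: subringB.
move=> _ _ [a Aa ->] [b Ab ->]; exists (a * b); last by rewrite rmorphM.
exact: subringM.
Qed.

Lemma frac_fieldP : is_skew_field_of_fractions frac_image frac_field.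
Proof.
apply: right_fractionsP; first exact: frac_image_subring.
- move=> _ [a Aa ->]; rewrite tofrac_mx_eq0 => a0.
  have : iota a \in unitmx.
    by rewrite unitmxE (det_map_mx (@tofrac R)) unitfE tofrac_eq0 det_neq0.
  by [].
- move=> _ _ [a Aa ->] [s As ->]; rewrite tofrac_mx_eq0 => s0.
  have [b [t [Ab At t0 ab]]] := conductor_right_ore Aa As s0.
  exists (iota b), (iota t); rewrite tofrac_mx_eq0 -!rmorphM ab.
  by split=> //; [exists b | exists t].
move=> _ _ [a Aa ->] [s As ->]; rewrite tofrac_mx_eq0 => s0.
have [b [t [Ab At t0 ab]]] := conductor_left_ore Aa As s0.
exists (iota b), (iota t); rewrite tofrac_mx_eq0 -!rmorphM ab.
by split=> //; [exists b | exists t].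
Qed.

(** Scalars z with z u in A lie in D, since u is invertible there; this covers
    the coefficients of det(1 - ta)^n, and extracting the n-th root gives those
    of det(1 - ta). *)
Lemma frac_field_char_coef : (exists2 c, A c%:M & c * n%:R = 1) ->
  forall a k, A a -> frac_field (iota (char_coef k a)%:M).
Proof.
move=> [c Ac cn] a k Aa.
have [[subD _ _] [_ AD invD _ _]] := frac_fieldP.
pose Z (f : {fraction R}) := frac_field f%:M.
have subZ : is_subring Z.
  split; first exact: subring1 subD.
    by move=> x y Zx Zy; rewrite /Z rmorphB; apply: (subringB subD).
  by move=> x y Zx Zy; rewrite /Z rmorphM; apply: (subringM subD).
have Au' : frac_image (iota u) by exists u.
have [v Dv [uv _]] : exists2 v, frac_field v & is_inverse (iota u) v.
  by apply: invD; split=> //; apply/eqP; rewrite tofrac_mx_eq0.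
pose q := map_poly (@tofrac R) (revdet a).
have Zq : forall j, Z q`_j.
  apply: (@coef_root_subring _ _ subZ q n).
  - exists (tofrac c); last by rewrite -(rmorph_nat (@tofrac R)) -rmorphM cn rmorph1.
    by rewrite /Z -map_scalar_mx; apply: AD; exists c%:M.
  - by rewrite coef_map /= coef0_revdet tofrac1.
  move=> j; rewrite -rmorphXn coef_map /Z.
  have -> : (tofrac ((revdet a ^+ n)`_j))%:M = iota ((revdet a ^+ n)`_j *: u) * v.
    by rewrite map_mxZ -scalerAl uv scalemx1.
  apply: (subringM subD) => //; apply: AD; eexists; last by [].
  by have [_ _] := condu Aa.
rewrite map_scalar_mx /= -/(Z _).
have := Zq k; rewrite coef_map /= coef_revdet -signr_odd mulr_sign.
by case: ifP => // _ /(subringN subZ); rewrite rmorphN opprK.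
Qed.

End FractionField.

(** * The cyclic grading and generic matrices *)

Section Graded.
Variables (R : idomainType) (n' : nat).
Local Notation n := n'.+2.
Variable sigma : {rmorphism R -> R}.

(** The exponent in R[u] stands for the degree, with values in Z/n after
    reduction (the cast k%:R to 'I_n); sigma is the shift along the diagonals. *)
Definition graded_mx (M : 'M[{poly R}]_n) : Prop :=
  (forall i j k, (M i j)`_k != 0 -> k%:R = j - i) /\
  (forall i j k, (M (i + 1) (j + 1))`_k = sigma (M i j)`_k).

(** The component T of lowest degree k0 is a weighted cyclic permutation matrix
    whose weights are deduced from each other by sigma, so none vanishes;
    det T is the lowest coefficient of det M. *)
Lemma graded_det_neq0 M : graded_mx M -> M != 0 -> \det M != 0.
Proof.
move=> [degM shiftM] M0.
have exk : exists k, [exists i, exists j, (M i j)`_k != 0].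
  have [i [j Mij]] : exists i, exists j, M i j != 0.
    case/matrix0Pn: M0 => i [j]; by exists i, j.
  exists (size (M i j)).-1; apply/existsP; exists i; apply/existsP; exists j.
  by rewrite -lead_coefE lead_coef_eq0.
(* k0 is the lowest degree that occurs in M, and N is M divided by 'X^k0. *)
case: (ex_minnP exk) => k0 /existsP[i0 /existsP[j0 M00]] mink.
pose N := map_mx (drop_poly k0) M.
have MN : M = 'X^k0 *: N.
  apply/matrixP => i j; rewrite !mxE -{1}(poly_take_drop k0 (M i j)) mulrC.
  rewrite -[RHS]add0r; congr (_ + _); apply/polyP => k; rewrite coef_take_poly coef0.
  case: ltnP => // ltk; apply/eqP; apply: contraLR ltk => Mk; rewrite -leqNgt.
  by apply: mink; apply/existsP; exists i; apply/existsP; exists j.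
rewrite MN detZ mulf_neq0 ?expf_neq0 ?polyX_eq0 //.
pose c : 'I_n := k0%:R; pose T : 'M[R]_n := \matrix_(i, j) (M i j)`_k0.
suff T0 : \det T != 0.
  have NT : map_mx (horner_eval 0) N = T.
    apply/matrixP => i j; rewrite !mxE /horner_eval horner_coef0.
    by rewrite coef_drop_poly.
  apply: contraNneq T0 => N0; by rewrite -NT det_map_mx N0 rmorph0.
pose d : 'rV[R]_n := \row_i T i (i + c).
have d_neq0 i : d 0 i != 0.
  (* Applying sigma repeatedly, a zero weight makes all later ones zero, and the
     indices are cyclic, so the entry M i0 j0 of degree k0 would vanish. *)
  apply: contraNneq M00 => di.
  have dk k : d 0 (i + k%:R) = 0.
    elim: k => [|k IHk]; first by rewrite addr0.
    move: IHk; rewrite !mxE -natr1 addrA => IHk.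
    by rewrite -[X in M _ X]addrA [1 + c]addrC addrA shiftM IHk rmorph0.
  have [eqc | nec] := eqVneq c (j0 - i0); last first.
    by apply: contraNT nec => /degM e; apply/eqP.
  have := dk (i0 - i); rewrite natr_Zp addrC subrK !mxE eqc addrC subrK.
  by move=> ->.
have -> : T = diag_mx d *m perm_mx (perm (addIr c)).
  rewrite mul_diag_mx; apply/matrixP => i j; rewrite !mxE permE.
  have [-> | ne] := eqVneq; first by rewrite mulr1.
  rewrite mulr0; apply/eqP; apply: contraNT ne => /degM kc.
  by rewrite /c kc addrC subrK eqxx.
rewrite det_mulmx det_diag det_perm mulf_neq0 ?signr_eq0 //.
by apply/prodf_neq0.
Qed.

Lemma graded_add M N : graded_mx M -> graded_mx N -> graded_mx (M + N).
Proof.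
move=> [degM shM] [degN shN]; split=> [i j k | i j k].
  rewrite mxE coefD; have [-> | /degM //] := eqVneq (M i j)`_k 0.
  by rewrite add0r => /degN.
by rewrite !mxE !coefD shM shN rmorphD.
Qed.

Lemma graded_mul M N :
  graded_mx M -> graded_mx N -> graded_mx (M *m N).
Proof.
move=> [degM shM] [degN shN]; split=> [i j k | i j k].
  apply: contraNeq => ne; rewrite mxE coef_sum big1 // => l _.
  rewrite coefM big1 // => e _; apply/eqP; apply: contraNT ne.
  rewrite mulf_eq0 negb_or => /andP[/degM e1 /degN e2].
  rewrite -(subnKC (ltnSE (ltn_ord e))) natrD e1 e2 addrC addrA subrK.
  exact: eqxx.
rewrite !mxE !coef_sum rmorph_sum (reindex_inj (addIr 1)) /=.
apply: eq_bigr => l _; rewrite !coefM rmorph_sum; apply: eq_bigr => e _.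
by rewrite shM shN rmorphM.
Qed.
End Graded.

Section Generic.
Variables (K : fieldType) (s n' : nat).
Local Notation n := n'.+2.
Local Notation Kx := {mpoly K[nvars s n]}.
Local Notation generic := (@generic_alg K s n).
Local Notation var nu i j := (enum_rank (nu, i, j) : 'I_(nvars s n)).

Lemma generic_subring G : is_subring (@generated_alg K s n G).
Proof.
have sc c : generated_alg G (c%:MP)%:M := gen_scalar G c.
split; first by rewrite -[1]/(1%:M) -mpolyC1.
  move=> a b Ga Gb; apply: gen_add => //.
  rewrite -mulN1r (_ : -1 = (((-1 : K)%:MP)%:M : 'M[Kx]_n)); first exact: gen_mul.
  by rewrite mpolyCN mpolyC1 rmorphN rmorph1.
by move=> a b Ga Gb; apply: gen_mul.
Qed.

(** Indices are added in 'I_n, that is, modulo n. *)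
Definition shift_morph : {rmorphism Kx -> Kx} :=
  mmap (@mpolyC _ K) (fun v : 'I_(nvars s n) =>
    let: (nu, i, j) := enum_val v in 'X_(var nu (i + 1) (j + 1))).

Definition grade_morph : {rmorphism Kx -> {poly Kx}} :=
  mmap (polyC \o @mpolyC _ K) (fun v : 'I_(nvars s n) =>
    let: (nu, i, j) := enum_val v in 'X^(val (j - i)%R) * ('X_v)%:P).

Lemma shift_morphX nu i j : shift_morph 'X_(var nu i j) = 'X_(var nu (i + 1) (j + 1)).
Proof. by rewrite /= mmapX mmap1U enum_rankK. Qed.

Lemma grade_morphX nu (i j : 'I_n) :
  grade_morph 'X_(var nu i j) = 'X^(val (j - i)%R) * ('X_(var nu i j))%:P.
Proof. by rewrite /= mmapX mmap1U enum_rankK. Qed.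

Lemma shift_morphC c : shift_morph c%:MP = c%:MP.
Proof. by rewrite /= mmapC. Qed.

Lemma grade_morphC c : grade_morph c%:MP = (c%:MP)%:P.
Proof. by rewrite /= mmapC. Qed.

Lemma subr_add2r (V : zmodType) (i j c : V) : j + c - (i + c) = j - i.
Proof. by rewrite opprD addrACA subrr addr0. Qed.

Lemma coefXnMC (R : nzRingType) d (c : R) k :
  ('X^d * c%:P)`_k = if k == d then c else 0.
Proof. by rewrite coefXnM coefC subn_eq0; case: ltngtP. Qed.

Lemma generic_graded a : generic a -> graded_mx shift_morph (map_mx grade_morph a).
Proof.
have := grade_morphC; have := shift_morphC; have := grade_morphX; have := shift_morphX.
move: shift_morph grade_morph => shift grade shiftX gradeX shiftC gradeC.
elim=> {a} [_ [nu ->] | c | a b _ IHa _ IHb | a b _ IHa _ IHb].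
- have gradeE i j k : (map_mx grade (generic_mx K n nu) i j)`_k =
      if k == val (j - i)%R then 'X_(var nu i j) else 0.
    by rewrite !mxE gradeX coefXnMC.
  split=> i j k.
    rewrite gradeE; case: (k =P _) => [-> _|]; first exact: natr_Zp.
    by rewrite eqxx.
  rewrite (gradeE i j k) (gradeE (i + 1) (j + 1) k) (subr_add2r i j 1).
  case: (k == _); first exact: (esym (shiftX nu i j)).
  exact: (esym (rmorph0 shift)).
- rewrite map_scalar_mx gradeC; split=> i j k; rewrite !mxE coefMn coefC.
    have [->|] := eqVneq i j; last by rewrite mulr0n eqxx.
    by case: k => [|k]; rewrite ?mul0rn ?eqxx // subrr.
  rewrite (inj_eq (addIr 1)) coefMn coefC rmorphMn.
  congr (_ *+ _); case: (k == _); first exact: (esym (shiftC c)).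
  exact: (esym (rmorph0 shift)).
- by rewrite map_mxD; apply: graded_add.
- rewrite map_mxM; exact: graded_mul.
Qed.

(** Setting the grading variable to 1 forgets the grading, so that the graded
    image of a determines a. *)
Lemma horner1_grade a : generic a ->
  map_mx (horner_eval 1) (map_mx grade_morph a) = a.
Proof.
have := grade_morphC; have := grade_morphX.
move: grade_morph => grade gradeX gradeC.
elim=> {a} [_ [nu ->] | c | a b _ IHa _ IHb | a b _ IHa _ IHb].
- apply/matrixP => i j; rewrite !mxE gradeX /horner_eval.
  by rewrite hornerM hornerXn expr1n mul1r hornerC.
- rewrite map_scalar_mx map_scalar_mx; congr _%:M.
  by rewrite gradeC; apply: hornerC.
- by rewrite (map_mxD grade) (map_mxD (horner_eval 1)) IHa IHb.
- by rewrite (map_mxM grade) (map_mxM (horner_eval 1)) IHa IHb.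
Qed.

Lemma generic_det_neq0 a : generic a -> a != 0 -> \det a != 0.
Proof.
move=> Ga a0; have gr := generic_graded Ga.
have : map_mx grade_morph a != 0.
  by apply: contraNneq a0 => ga; rewrite -(horner1_grade Ga) ga map_mx0.
move/(graded_det_neq0 gr); rewrite det_map_mx; apply: contraNneq => ->.
by rewrite rmorph0.
Qed.

Hypothesis s_ge2 : (2 <= s)%N.

(** The first generic matrix becomes the cyclic permutation matrix, all the
    others become E_00. *)
Definition spec_point (v : 'I_(nvars s n)) : K :=
  let: (nu, i, j) := enum_val v in
  if val nu == 0%N then (j == i + 1)%:R else ((i == 0) && (j == 0))%:R.

(** With C the cyclic permutation matrix, C^p E_00 C^q is the matrix unit
    with row -p and column q. *)
Lemma generic_units i j :
  exists2 a, generic a & map_mx (meval spec_point) a = delta_mx i j.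
Proof.
pose nu0 : 'I_s := Ordinal (ltn_trans (ltn0Sn 0) s_ge2).
pose nu1 : 'I_s := Ordinal s_ge2.
have subG := generic_subring (fun a => exists nu, a = @generic_mx K s n nu).
have specE nu : map_mx (meval spec_point) (generic_mx K n nu) =
    \matrix_(i, j) (if val nu == 0%N then (j == i + 1)%:R
                    else ((i == 0) && (j == 0))%:R).
  by apply/matrixP => p q; rewrite !mxE mevalXU /spec_point enum_rankK.
have spec0 k : map_mx (meval spec_point) (generic_mx K n nu0 ^+ k) =
    \matrix_(i, j) (j == i + k%:R)%:R.
  elim: k => [|k IHk].
    rewrite expr0 rmorph1; apply/matrixP => p q.
    by rewrite !mxE addr0 eq_sym.
  rewrite exprSr rmorphM /= IHk specE; apply/matrixP => p q; rewrite !mxE.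
  rewrite (bigD1 (p + k%:R)) //= !mxE eqxx mul1r big1 ?addr0 => [|l ne].
    by rewrite -natr1 addrA.
  by rewrite !mxE (negbTE ne) mul0r.
have [i' i'E] : exists i', - i = i' by exists (- i).
(* The equation i' = - i is kept abstract so that simplification does not
   unfold the opposite modulo n. *)
exists (generic_mx K n nu0 ^+ val i' * generic_mx K n nu1 *
        generic_mx K n nu0 ^+ val j).
  apply: (subringM subG); first apply: (subringM subG).
  - by apply: (subringX subG); apply: gen_base; exists nu0.
  - by apply: gen_base; exists nu1.
  - by apply: (subringX subG); apply: gen_base; exists nu0.
rewrite !rmorphM /= !spec0 specE !natr_Zp; apply/matrixP => p q; rewrite !mxE.
rewrite (bigD1 0) //= big1 ?addr0 => [|l ne].
  rewrite !mxE (bigD1 0) //= big1 ?addr0 => [|l ne].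
    rewrite !mxE /= mulr1 add0r -natrM mulnb; congr (_ && _)%:R.
    by rewrite eq_sym -i'E subr_eq0.
  by rewrite !mxE /= (negbTE ne) mulr0.
rewrite !mxE big1 ?mul0r // => l' _; rewrite !mxE /= (negbTE ne) andbF.
by rewrite mulr0.
Qed.
End Generic.

(** * The skew field of fractions of the generic matrices *)

Section Main.
Variables (K : fieldType) (s n' : nat).
Local Notation n := n'.+2.
Local Notation Kx := {mpoly K[nvars s n]}.
Local Notation generic := (@generic_alg K s n).
Hypotheses (s_ge2 : (2 <= s)%N) (n_neq0 : n%:R != 0 :> K).

Lemma generated_alg_sub (G D : 'M[Kx]_n -> Prop) :
  is_subring D -> (forall c, D (c%:MP)%:M) -> (forall a, G a -> D a) ->
  forall a, generated_alg G a -> D a.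
Proof.
move=> subD Dc DG a; elim=> {a} [a /DG // | c // | a b _ Da _ Db | a b _ Da _ Db].
  exact: (subringD subD).
exact: (subringM subD).
Qed.

Lemma generic_is_domain : is_domain generic.
Proof.
split; first by apply/eqP/oner_neq0.
move=> a b Ga Gb ab0.
have [-> | a0] := eqVneq a 0; [by left | right].
apply/eqP; apply: contraT => b0.
have := subring_mul_neq0 (@generic_det_neq0 K s n') Ga Gb a0 b0.
by rewrite -[_ * _]/(a * b) ab0 eqxx.
Qed.

(** For n invertible in K the three algebras share one skew field of fractions,
    whatever the characteristic. *)
Lemma generic_main : exists D : 'M[{fraction Kx}]_n -> Prop,
  [/\ is_skew_field_of_fractions (in_frac generic) D,
      is_skew_field_of_fractions (in_frac (@generic_alg_traces K s n)) D &
      is_skew_field_of_fractions (in_frac (@generic_alg_forms K s n)) D].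
Proof.
have subG : is_subring generic := generic_subring _.
have [u [Gu u0 condu]] := conductor subG (@generic_units K s n' s_ge2).
have detG := @generic_det_neq0 K s n'.
have fracG := frac_fieldP subG detG Gu u0 condu.
exists (frac_field generic).
have cG : exists2 c, generic c%:M & c * n%:R = 1.
  exists (n%:R^-1)%:MP; first exact: gen_scalar.
  by rewrite -(rmorph_nat (@mpolyC _ K)) -mpolyCM mulVf ?mpolyC1.
have charD a k : generic a -> frac_field generic (map_mx (@tofrac Kx) (char_coef k a)%:M).
  exact: (frac_field_char_coef subG detG Gu u0 condu cG).
have [[subD _ _] [_ GD _ _ _]] := fracG.
pose D0 (a : 'M[Kx]_n) := frac_field generic (map_mx (@tofrac Kx) a).
have subD0 : is_subring D0.
  rewrite /D0; split; first by rewrite rmorph1; apply: subring1 subD.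
    by move=> a b Da Db; rewrite rmorphB; apply: (subringB subD).
  by move=> a b Da Db; rewrite rmorphM; apply: (subringM subD).
have GD0 a : generic a -> D0 a by move=> Ga; apply: GD; exists a.
have between G : (forall a, generic a -> G a) -> (forall a, G a -> D0 a) ->
    is_skew_field_of_fractions (in_frac (generated_alg G)) (frac_field generic).
  move=> GG GD'; apply: skew_field_of_fractions_between fracG.
    by move=> _ [a Ga ->]; exists a => //; apply/gen_base/GG.
  move=> _ [a Ga ->]; apply: (generated_alg_sub subD0 _ GD' Ga) => c.
  exact/GD0/gen_scalar.
split=> //; apply: between => a; try by left.
  by case=> [/GD0 // | [b Gb ->]]; rewrite -char_coef1; apply: charD.
by case=> [/GD0 // | [b [k [Gb _ ->]]]]; apply: charD.
Qed.
End Main.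

(** Any N beyond the characteristic works; excluded middle decides whether the
    characteristic is positive. *)
Lemma large_primes_neq0 (K : fieldType) :
  exists N, forall n, prime n -> (N <= n)%N -> n%:R != 0 :> K.
Proof.
have [[p Kp] | noK] := classic (exists p, p \in [pchar K]).
  exists p.+1 => n n_pr lt_pn; rewrite -(dvdn_pcharf Kp).
  by rewrite (dvdn_prime2 (pcharf_prime Kp) n_pr) ltn_eqF.
exists 0%N => n n_pr _.
have /pcharf0P -> : [pchar K] =i pred0.
  by move=> p; apply/negP => Kp; apply: noK; exists p.
by rewrite -lt0n prime_gt0.
Qed.

Theorem theorem0p1 (K : fieldType) (s : nat) (hs : (2 <= s)%N) :
  exists N : nat, forall n : nat, prime n -> (N <= n)%N ->
    is_domain (@generic_alg K s n) /\
    exists D : 'M[{fraction {mpoly K[nvars s n]}}]_n -> Prop,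
      [/\ is_skew_field_of_fractions (in_frac (@generic_alg K s n)) D,
          [pchar K] =i pred0 ->
            is_skew_field_of_fractions (in_frac (@generic_alg_traces K s n)) D &
          forall p : nat, p \in [pchar K] ->
            is_skew_field_of_fractions (in_frac (@generic_alg_forms K s n)) D].
Proof.
have [N N_neq0] := large_primes_neq0 K.
exists N => -[|[|n']] // n_pr le_Nn.
split; first exact: generic_is_domain.
by have [D [? ? ?]] := generic_main hs (N_neq0 _ n_pr le_Nn); exists D.
Qed.
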